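(* Let $p$ be a prime number, $d\ge 1$ an integer, and $g\in\mathbb{F}_p[x]\setminus\big(\bigcup_{j\ge 0}\mathbb{F}_p x^j\cup (x-1)\mathbb{F}_p[x]\big)$. Let $\widetilde{G}=\widetilde{A}\rtimes\widetilde{Q}$, where $$\widetilde{A}=\mathbb{F}_p\Big[x_1^{\pm1},\tfrac{1}{g(x_1)}\Big]\otimes_{\mathbb{F}_p}\cdots\otimes_{\mathbb{F}_p}\mathbb{F}_p\Big[x_d^{\pm1},\tfrac{1}{g(x_d)}\Big],$$ $\widetilde{Q}=\mathbb{Z}^{2d}=\langle x_1,\ldots,x_d,y_1,\ldots,y_d\rangle$ is free abelian on the listed generators, and $y_i$ and $x_i$ act on $\widetilde{A}$ (via conjugation) as multiplication by $g(x_i)$ and $x_i$ respectively. Then $\widetilde{G}$ is a transitive self-similar group.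
   Context: For an integer $k\ge 1$, $\mathcal{T}_k$ is the infinite regular one-rooted $k$-tree (every vertex has exactly $k$ descendants on the next level) and $\mathrm{Aut}(\mathcal{T}_k)$ is its group of level-preserving automorphisms. The first level is identified with $\{0,\ldots,k-1\}$, and every $g\in \mathrm{Aut}(\mathcal{T}_k)$ is written uniquely as $g=(g_0,\ldots,g_{k-1})\sigma$, where $\sigma$ is the permutation of the first level induced by $g$ and $g_i\in\mathrm{Aut}(\mathcal{T}_k)$ is the induced action on the subtree headed by the vertex $i$ (identified with $\mathcal{T}_k$). A subgroup $G\le\mathrm{Aut}(\mathcal{T}_k)$ is state-closed if $g_i\in G$ for all $g\in G$ and all $i$. A group is transitive self-similar if, for some $k$, it is isomorphic to a state-closed subgroup of $\mathrm{Aut}(\mathcal{T}_k)$ acting transitively on the first level of $\mathcal{T}_k$. *)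

(* Defs.v *)
From HB Require Import structures.
From mathcomp Require Import all_boot all_order all_algebra.
From mathcomp Require Import boolp.

Set Implicit Arguments.
Unset Strict Implicit.
Unset Printing Implicit Defensive.

Import GRing.Theory.

Local Open Scope ring_scope.

(* The vertices of the tree are the words over 'I_k: the root is [::], the   *)
(* n-th level consists of the words of size n, and v is an ancestor of w iff *)
(* v is a prefix of w.                                                       *)
Definition is_tree_aut (k : nat) (f : seq 'I_k -> seq 'I_k) : Prop :=
  [/\ bijective f,
      forall w, size (f w) = size w &
      forall v w, prefix v w -> prefix (f v) (f w)].

Record tree_aut (k : nat) := TreeAut {
  tree_aut_fun :> seq 'I_k -> seq 'I_k;
  _ : `[< is_tree_aut tree_aut_fun >] }.

HB.instance Definition _ (k : nat) := [isSub for @tree_aut_fun k].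
HB.instance Definition _ (k : nat) := [Choice of tree_aut k by <:].

Section TreeAut.
Variable k : nat.
Implicit Types (f g : tree_aut k) (v w : seq 'I_k).

Lemma tree_autP f : is_tree_aut f.
Proof. exact/asboolP/(valP f). Qed.

Lemma tree_aut_inj f : injective f.
Proof. by have [/bij_inj] := tree_autP f. Qed.

Lemma size_tree_aut f w : size (f w) = size w.
Proof. by have [_ ->] := tree_autP f. Qed.

Lemma prefix_tree_aut f v w : prefix v w -> prefix (f v) (f w).
Proof. by have [_ _] := tree_autP f; apply. Qed.

Lemma tree_aut_eq f g : f =1 g -> f = g.
Proof. by move=> fg; apply/val_inj/funext. Qed.

Lemma tree_aut1_subproof : `[< is_tree_aut (@id (seq 'I_k)) >].
Proof. by apply/asboolP; split=> //; exists id. Qed.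

Lemma tree_aut_mul_subproof f g : `[< is_tree_aut (f \o g) >].
Proof.
apply/asboolP; have [bf _ _] := tree_autP f; have [bg _ _] := tree_autP g.
split=> [|w|v w vw]; first exact: bij_comp.
- by rewrite /= !size_tree_aut.
- by do 2! apply: prefix_tree_aut.
Qed.

Lemma tree_aut_inv_ex f : exists h, cancel f h /\ cancel h f.
Proof. by have [[h fK hK] _ _] := tree_autP f; exists h. Qed.

Definition tree_aut_inv_fun f : seq 'I_k -> seq 'I_k :=
  projT1 (cid (tree_aut_inv_ex f)).

Lemma tree_aut_invK f :
  cancel f (tree_aut_inv_fun f) /\ cancel (tree_aut_inv_fun f) f.
Proof. by rewrite /tree_aut_inv_fun; case: cid. Qed.

Lemma tree_aut_inv_subproof f : `[< is_tree_aut (tree_aut_inv_fun f) >].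
Proof.
have [fK hK] := tree_aut_invK f; set h := tree_aut_inv_fun f in fK hK *.
have sh w : size (h w) = size w by rewrite -[in RHS](hK w) size_tree_aut.
apply/asboolP; split=> // [|v w vw]; first by exists f.
have := prefix_tree_aut f (prefix_take (h w) (size v)).
have le_vw : (size v <= size w)%N by exact: size_prefix.
rewrite hK !prefixE size_tree_aut size_takel ?sh // => /eqP e.
rewrite prefixE in vw; rewrite (eqP vw) in e.
by apply/eqP/(tree_aut_inj (f := f)); rewrite -e hK.
Qed.

(* The product is composition. Composing in the opposite order (right        *)
(* actions) gives the opposite group, hence an isomorphic one via inversion, *)
(* with the same subgroups and, below, the same states.                      *)
Definition tree_aut_mul f g := TreeAut (tree_aut_mul_subproof f g).

Lemma tree_aut_mulA : associative tree_aut_mul.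
Proof. by move=> f g h; apply: tree_aut_eq. Qed.

Lemma tree_aut_mul1 : left_id (TreeAut tree_aut1_subproof) tree_aut_mul.
Proof. by move=> f; apply: tree_aut_eq. Qed.

Lemma tree_aut_mulr1 : right_id (TreeAut tree_aut1_subproof) tree_aut_mul.
Proof. by move=> f; apply: tree_aut_eq. Qed.

Lemma tree_aut_mulV : left_inverse (TreeAut tree_aut1_subproof)
  (fun f => TreeAut (tree_aut_inv_subproof f)) tree_aut_mul.
Proof. by move=> f; apply: tree_aut_eq => w /=; case: (tree_aut_invK f). Qed.

Lemma tree_aut_mulrV : right_inverse (TreeAut tree_aut1_subproof)
  (fun f => TreeAut (tree_aut_inv_subproof f)) tree_aut_mul.
Proof. by move=> f; apply: tree_aut_eq => w /=; case: (tree_aut_invK f). Qed.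

HB.instance Definition _ := isGroup.Build (tree_aut k) tree_aut_mulA
  tree_aut_mul1 tree_aut_mulr1 tree_aut_mulV tree_aut_mulrV.

(* f (i :: w) = j :: f_i w, where [:: j] = f [:: i] and f_i is the state. *)
Lemma tree_aut_cons f i w : f (i :: w) = f [:: i] ++ behead (f (i :: w)).
Proof.
have : prefix [:: i] (i :: w) by rewrite prefix_cons eqxx prefix0s.
move/(prefix_tree_aut f)/prefixP => [s ->].
have := size_tree_aut f [:: i].
by case: (f [:: i]) => [|j [|]].
Qed.

Lemma state_subproof f i : `[< is_tree_aut (fun w => behead (f (i :: w))) >].
Proof.
pose h w := behead (tree_aut_inv_fun f (f [:: i] ++ w)).
have [fK hK] := tree_aut_invK f.
apply/asboolP; split=> [|w|v w vw].
- exists h => w; rewrite /h; first by rewrite -tree_aut_cons fK.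
  set u := tree_aut_inv_fun f _.
  have fu : f u = f [:: i] ++ w by rewrite hK.
  have : prefix (f [:: i]) (f u) by rewrite fu prefix_prefix.
  have su : size u = (size w).+1.
    by rewrite -(size_tree_aut f) fu size_cat size_tree_aut.
  case: u su fu => [|j u] //= _ fu.
  rewrite (tree_aut_cons f j u) -[f [:: i]]cats0 prefix_catr ?size_tree_aut //.
  move=> /andP[/eqP/tree_aut_inj[ji] _]; rewrite -ji (tree_aut_cons f i u) in fu.
  by move/eqP: fu; rewrite eqseq_cat // => /andP[_ /eqP].
- by rewrite size_behead size_tree_aut.
- have : prefix (i :: v) (i :: w) by rewrite prefix_cons eqxx.
  move/(prefix_tree_aut f).
  rewrite [f (i :: v)]tree_aut_cons [f (i :: w)]tree_aut_cons prefix_catr //.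
  by rewrite eqxx -!tree_aut_cons.
Qed.

Definition state f (i : 'I_k) : tree_aut k := TreeAut (state_subproof f i).

End TreeAut.

Definition state_closed (k : nat) (H : {pred tree_aut k}) : Prop :=
  forall h, h \in H -> forall i, state h i \in H.

Definition level1_transitive (k : nat) (H : {pred tree_aut k}) : Prop :=
  forall i j : 'I_k, exists2 h : tree_aut k, h \in H & h [:: i] = [:: j].

Definition transitive_self_similar (G : groupType) : Prop :=
  exists k : nat, (0 < k)%N /\
  exists H : {pred tree_aut k},
    [/\ group_closed H, state_closed H, level1_transitive H &
        exists phi : {multiplicative G -> tree_aut k},
          injective phi /\ (forall h, h \in H <-> exists x, phi x = h)].

Record zmod_action (Q A : zmodType) := ZmodAction {
  zact :> Q -> A -> A;
  zact_add : forall q, {morph zact q : a b / a + b};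
  zact0 : forall a, zact 0 a = a;
  zactD : forall q r a, zact (q + r) a = zact q (zact r a) }.

(* The pair (a, q) stands for the product a * q, so that                     *)
(* q * a * q^-1 = rho q a; see sdprod_conj.                                  *)
Definition sdprod (Q A : zmodType) (rho : zmod_action Q A) : Type :=
  (A * Q)%type.

Section SemiDirect.
Variables (Q A : zmodType) (rho : zmod_action Q A).
Implicit Types x y : sdprod rho.

HB.instance Definition _ := Choice.copy (sdprod rho) (A * Q)%type.

Definition sdprod_mul x y : sdprod rho := (x.1 + rho x.2 y.1, x.2 + y.2).
Definition sdprod_one : sdprod rho := (0, 0).
Definition sdprod_inv x : sdprod rho := (rho (- x.2) (- x.1), - x.2).

Lemma zactr0 q : rho q 0 = 0.
Proof. by apply: (@addIr _ (rho q 0)); rewrite -zact_add !add0r. Qed.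

Lemma sdprod_mulA : associative sdprod_mul.
Proof.
by move=> x y z; rewrite /sdprod_mul /= zact_add zactD !addrA.
Qed.

Lemma sdprod_mul1 : left_id sdprod_one sdprod_mul.
Proof. by case=> a q; rewrite /sdprod_mul /= zact0 !add0r. Qed.

Lemma sdprod_mulr1 : right_id sdprod_one sdprod_mul.
Proof. by case=> a q; rewrite /sdprod_mul /= zactr0 !addr0. Qed.

Lemma sdprod_mulV : left_inverse sdprod_one sdprod_inv sdprod_mul.
Proof.
by case=> a q; rewrite /sdprod_mul /= -zact_add !addNr zactr0.
Qed.

Lemma sdprod_mulrV : right_inverse sdprod_one sdprod_inv sdprod_mul.
Proof.
by case=> a q; rewrite /sdprod_mul /= -zactD !addrN zact0 addrN.
Qed.

HB.instance Definition _ := isGroup.Build (sdprod rho) sdprod_mulA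
  sdprod_mul1 sdprod_mulr1 sdprod_mulV sdprod_mulrV.

Lemma sdprod_conj (q : Q) (a : A) :
  (((0, q) : sdprod rho) * ((a, 0) : sdprod rho) * ((0, q) : sdprod rho)^-1)%g
  = (rho q a, 0) :> sdprod rho.
Proof.
rewrite /monoid.mul /monoid.inv /= /sdprod_mul /=.
by rewrite oppr0 zactr0 zactr0 addr0 add0r addr0 addrN.
Qed.

End SemiDirect.

Definition upd (I : finType) (T : Type) (b : {ffun I -> T}) (i : I) (x : T) :
    {ffun I -> T} :=
  [ffun j => if j == i then x else b j].

Definition multilinear (R : pzRingType) (B W : lmodType R) (I : finType)
    (m : {ffun I -> B} -> W) : Prop :=
  forall (b : {ffun I -> B}) (i : I) (c : R) (x y : B),
    m (upd b i (c *: x + y)) = c *: m (upd b i x) + m (upd b i y).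

Section TensorPower.
Variables (R : comNzRingType) (B : comAlgType R) (I : finType).
Implicit Types (W : lmodType R) (b : {ffun I -> B}).

(* The list [:: (c_1, b_1), ..., (c_n, b_n)] stands for the formal sum of    *)
(* the c_k *: (tensor product over i of b_k i).                              *)
Definition formal_sum := seq (R * {ffun I -> B}).

Definition formal_eval W (m : {ffun I -> B} -> W) (s : formal_sum) : W :=
  \sum_(u <- s) u.1 *: m u.2.

(* Formal sums are identified when every multilinear map takes the same      *)
(* value on them, so that the quotient has the universal property of the     *)
(* I-fold tensor power of B over R; see tensor_univ.                         *)
Definition formal_equiv (s t : formal_sum) : bool :=
  `[< forall W (m : {ffun I -> B} -> W), multilinear m ->
      formal_eval m s = formal_eval m t >].

Lemma formal_equiv_refl : reflexive formal_equiv.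
Proof. by move=> s; apply/asboolP. Qed.

Lemma formal_equiv_sym : symmetric formal_equiv.
Proof.
by move=> s t; apply/asboolP/asboolP => st W m mP; rewrite st.
Qed.

Lemma formal_equiv_trans : transitive formal_equiv.
Proof.
move=> t s u /asboolP st /asboolP tu; apply/asboolP => W m mP.
by rewrite st // tu.
Qed.

Canonical formal_equiv_rel := EquivRel formal_equiv formal_equiv_refl
  formal_equiv_sym formal_equiv_trans.

Definition tensor_power : Type := {eq_quot formal_equiv_rel}%qT.

HB.instance Definition _ := Choice.on tensor_power.

Definition tensor_class (s : formal_sum) : tensor_power :=
  \pi_{eq_quot formal_equiv_rel}%qT s.

Definition tensor_repr (x : tensor_power) : formal_sum :=
  repr (x : {eq_quot formal_equiv_rel}%qT).

Definition tensor_lift W (m : {ffun I -> B} -> W) (x : tensor_power) : W :=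
  formal_eval m (tensor_repr x).

Definition pure b : tensor_power := tensor_class [:: (1, b)].

Lemma tensor_reprK : cancel tensor_repr tensor_class.
Proof. exact: reprK. Qed.

Lemma lift_class W (m : {ffun I -> B} -> W) s : multilinear m ->
  tensor_lift m (tensor_class s) = formal_eval m s.
Proof.
move=> mP; have : formal_equiv (tensor_repr (tensor_class s)) s.
  by apply/eqmodP; exact: tensor_reprK.
by move/asboolP; apply.
Qed.

Lemma tensor_ext (x y : tensor_power) :
  (forall W (m : {ffun I -> B} -> W), multilinear m ->
     tensor_lift m x = tensor_lift m y) -> x = y.
Proof.
move=> xy; rewrite -(tensor_reprK x) -(tensor_reprK y).
by apply/eqmodP/asboolP => W m /xy.
Qed.

Definition tensor_add (x y : tensor_power) : tensor_power :=
  tensor_class (tensor_repr x ++ tensor_repr y).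
Definition tensor_scale (c : R) (x : tensor_power) : tensor_power :=
  tensor_class [seq (c * u.1, u.2) | u <- tensor_repr x].
Definition tensor_mul (x y : tensor_power) : tensor_power :=
  tensor_class [seq (u.1 * v.1, u.2 * v.2) | u <- tensor_repr x,
                                             v <- tensor_repr y].

Lemma lift0 W (m : {ffun I -> B} -> W) : multilinear m ->
  tensor_lift m (tensor_class [::]) = 0.
Proof. by move=> mP; rewrite lift_class // /formal_eval big_nil. Qed.

Lemma liftD W (m : {ffun I -> B} -> W) x y : multilinear m ->
  tensor_lift m (tensor_add x y) = tensor_lift m x + tensor_lift m y.
Proof. by move=> mP; rewrite lift_class // /formal_eval big_cat. Qed.

Lemma liftZ W (m : {ffun I -> B} -> W) c x : multilinear m ->
  tensor_lift m (tensor_scale c x) = c *: tensor_lift m x.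
Proof.
move=> mP; rewrite lift_class // /tensor_lift /formal_eval big_map scaler_sumr.
by apply: eq_bigr => u _; rewrite scalerA.
Qed.

Lemma lift_pure W (m : {ffun I -> B} -> W) b : multilinear m ->
  tensor_lift m (pure b) = m b.
Proof.
by move=> mP; rewrite lift_class // /formal_eval big_seq1 scale1r.
Qed.

Lemma liftM W (m : {ffun I -> B} -> W) x y : multilinear m ->
  tensor_lift m (tensor_mul x y) =
  tensor_lift (fun a => tensor_lift (fun b => m (a * b)) y) x.
Proof.
move=> mP; rewrite lift_class // /tensor_lift /formal_eval big_allpairs_dep /=.
apply: eq_bigr => u _; rewrite scaler_sumr; apply: eq_bigr => v _.
by rewrite scalerA.
Qed.

Lemma eq_lift W (m m' : {ffun I -> B} -> W) : m =1 m' ->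
  tensor_lift m =1 tensor_lift m'.
Proof. by move=> mm' x; apply: eq_bigr => u _; rewrite mm'. Qed.

Lemma upd_mul a b i x : a * upd b i x = upd (a * b) i (a i * x).
Proof. by apply/ffunP => j; rewrite !ffunE; case: eqP => // ->. Qed.

Lemma ffunMC a b : a * b = b * a :> {ffun I -> B}.
Proof. by apply/ffunP => j; rewrite !ffunE mulrC. Qed.

Lemma multilinear_mull W (m : {ffun I -> B} -> W) a :
  multilinear m -> multilinear (fun b => m (a * b)).
Proof.
by move=> mP b i c x y; rewrite !upd_mul mulrDr -scalerAr mP.
Qed.

Lemma multilinear_mulr W (m : {ffun I -> B} -> W) a :
  multilinear m -> multilinear (fun b => m (b * a)).
Proof.
by move=> mP b i c x y; rewrite ![_ * a]ffunMC; apply: multilinear_mull.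
Qed.

Lemma multilinear_lift W (m : {ffun I -> B} -> {ffun I -> B} -> W) y :
  (forall b, multilinear (m^~ b)) -> multilinear (fun a => tensor_lift (m a) y).
Proof.
move=> mP b i c x z; rewrite /tensor_lift /formal_eval scaler_sumr -big_split.
apply: eq_bigr => u _ /=; rewrite mP scalerDr; congr (_ + _).
by rewrite !scalerA mulrC.
Qed.

Lemma multilinear_lift_mul W (m : {ffun I -> B} -> W) y : multilinear m ->
  multilinear (fun a => tensor_lift (fun b => m (a * b)) y).
Proof.
move=> mP; apply: (@multilinear_lift _ (fun a b => m (a * b))) => b.
exact: multilinear_mulr.
Qed.

Lemma tensor_addA : associative tensor_add.
Proof. by move=> x y z; apply: tensor_ext => W m mP; rewrite !liftD // addrA. Qed.

Lemma tensor_addC : commutative tensor_add.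
Proof. by move=> x y; apply: tensor_ext => W m mP; rewrite !liftD // addrC. Qed.

Lemma tensor_add0 : left_id (tensor_class [::]) tensor_add.
Proof.
by move=> x; apply: tensor_ext => W m mP; rewrite liftD // lift0 // add0r.
Qed.

Lemma tensor_addN :
  left_inverse (tensor_class [::]) (tensor_scale (-1)) tensor_add.
Proof.
move=> x; apply: tensor_ext => W m mP.
by rewrite liftD // liftZ // lift0 // scaleN1r addNr.
Qed.

HB.instance Definition _ := GRing.isZmodule.Build tensor_power
  tensor_addA tensor_addC tensor_add0 tensor_addN.

Lemma tensor_scaleA c d x :
  tensor_scale c (tensor_scale d x) = tensor_scale (c * d) x.
Proof. by apply: tensor_ext => W m mP; rewrite !liftZ // scalerA. Qed.

Lemma tensor_scale1 : left_id 1 tensor_scale.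
Proof. by move=> x; apply: tensor_ext => W m mP; rewrite liftZ // scale1r. Qed.

Lemma tensor_scaleDr : right_distributive tensor_scale +%R.
Proof.
move=> c x y; apply: tensor_ext => W m mP.
by rewrite liftZ // !liftD // !liftZ // scalerDr.
Qed.

Lemma tensor_scaleDl x : {morph tensor_scale^~ x : c d / c + d}.
Proof.
move=> c d; apply: tensor_ext => W m mP.
by rewrite liftZ // liftD // !liftZ // scalerDl.
Qed.

HB.instance Definition _ := GRing.Zmodule_isLmodule.Build R tensor_power
  tensor_scaleA tensor_scale1 tensor_scaleDr tensor_scaleDl.

Lemma tensor_mulC : commutative tensor_mul.
Proof.
move=> x y; apply: tensor_ext => W m mP; rewrite !liftM //.
rewrite /tensor_lift /formal_eval.
under eq_bigr do rewrite scaler_sumr.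
rewrite exchange_big; apply: eq_bigr => u _; rewrite scaler_sumr.
by apply: eq_bigr => v _; rewrite !scalerA mulrC ffunMC.
Qed.

Lemma tensor_mulA : associative tensor_mul.
Proof.
move=> x y z; apply: tensor_ext => W m mP; rewrite !liftM //; last first.
  exact: multilinear_lift_mul.
apply: eq_lift => a; rewrite liftM; last exact: multilinear_mull.
by apply: eq_lift => b; apply: eq_lift => c; rewrite mulrA.
Qed.

Lemma tensor_mul1 : left_id (pure 1) tensor_mul.
Proof.
move=> x; apply: tensor_ext => W m mP; rewrite liftM // lift_pure.
  by apply: eq_lift => b; rewrite mul1r.
exact: multilinear_lift_mul.
Qed.

Lemma tensor_mulDl : left_distributive tensor_mul +%R.
Proof.
move=> x y z; apply: tensor_ext => W m mP.
by rewrite liftM // !liftD // ?liftM //; apply: multilinear_lift_mul.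
Qed.

HB.instance Definition _ := GRing.Zmodule_isComPzRing.Build tensor_power
  tensor_mulA tensor_mulC tensor_mul1 tensor_mulDl.

Lemma pure_multilinear : multilinear pure.
Proof.
move=> b i c x y; apply: tensor_ext => W m mP.
by rewrite liftD // liftZ // !lift_pure.
Qed.

Lemma pureM a b : pure (a * b) = pure a * pure b.
Proof.
apply: tensor_ext => W m mP; rewrite liftM // !lift_pure //.
  exact: multilinear_mull.
exact: multilinear_lift_mul.
Qed.

Lemma pure1 : pure 1 = 1.
Proof. by []. Qed.

Lemma tensor_repr_sum x : x = \sum_(u <- tensor_repr x) u.1 *: pure u.2.
Proof.
have lift_sum W (m : {ffun I -> B} -> W) (s : formal_sum) : multilinear m ->
    tensor_lift m (\sum_(u <- s) u.1 *: pure u.2) = formal_eval m s.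
  move=> mP; rewrite /formal_eval; elim: s => [|u s IHs].
    by rewrite !big_nil lift0.
  by rewrite !big_cons liftD // liftZ // lift_pure // IHs.
by apply: tensor_ext => W m mP; rewrite lift_sum.
Qed.

Lemma tensor_scaleAl (c : R) (x y : tensor_power) : c *: (x * y) = (c *: x) * y.
Proof.
apply: tensor_ext => W m mP; rewrite liftZ // !liftM // liftZ //.
exact: multilinear_lift_mul.
Qed.

Lemma tensor_univ W (m : {ffun I -> B} -> W) : multilinear m ->
  exists! f : tensor_power -> W, linear f /\ forall b, f (pure b) = m b.
Proof.
move=> mP; exists (tensor_lift m); split.
  split=> [c x y|b]; last exact: lift_pure.
  by rewrite liftD // liftZ.
move=> f [f_lin f_pure]; apply/funext => x; rewrite {2}(tensor_repr_sum x).
rewrite /tensor_lift /formal_eval; elim: (tensor_repr x) => [|u s IHs].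
  by have := f_lin (-1) 0 0; rewrite !big_nil scaler0 addr0 scaleN1r addNr => ->.
by rewrite !big_cons f_lin f_pure IHs.
Qed.

End TensorPower.

Section LocalizedPoly.
Variables (F : fieldType) (g : {poly F}).

Local Notation "h %:F" := (tofrac h) : ring_scope.
Local Notation K := {fraction {poly F}}.
Local Notation s := (('X * g)%:F : K).

(* For g != 0: the fractions of F(x) with denominator a power of x * g. *)
Definition is_localized : {pred K} :=
  [pred u | `[< exists (h : {poly F}) (n : nat), u = h%:F / s ^+ n >]].

Lemma is_localizedP (u : K) :
  reflect (exists (h : {poly F}) (n : nat), u = h%:F / s ^+ n)
          (u \in is_localized).
Proof. exact: asboolP. Qed.

Lemma localized_subring : subring_closed is_localized.
Proof.
have [s0|s_neq0] := eqVneq s 0.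
  have poly u : u \in is_localized -> exists h : {poly F}, u = h%:F.
    move=> /is_localizedP[h [[|n] ->]]; first by exists h; rewrite expr0 divr1.
    by exists 0; rewrite s0 expr0n invr0 mulr0 tofrac0.
  have polyl (h : {poly F}) : h%:F \in is_localized.
    by apply/is_localizedP; exists h, 0%N; rewrite expr0 divr1.
  split=> [|u v /poly[a ->] /poly[b ->]|u v /poly[a ->] /poly[b ->]].
  - by rewrite -tofrac1.
  - by rewrite -tofracB.
  - by rewrite -tofracM.
split=> [|_ _ /is_localizedP[a [m ->]] /is_localizedP[b [n ->]]
         |_ _ /is_localizedP[a [m ->]] /is_localizedP[b [n ->]]].
- by apply/is_localizedP; exists 1, 0%N; rewrite tofrac1 expr0 divr1.
- apply/is_localizedP.
  exists (a * ('X * g) ^+ n - b * ('X * g) ^+ m), (m + n)%N.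
  rewrite -mulNr addf_div ?expf_neq0 // exprD tofracB !(tofracM _ (_ ^+ _)).
  by rewrite !tofracXn mulNr.
- apply/(introT (is_localizedP _)); exists (a * b), (m + n)%N.
  by rewrite (tofracM a) exprD; exact: mulf_div.
Qed.

HB.instance Definition _ :=
  GRing.isSubringClosed.Build K is_localized localized_subring.

Record localized_poly := LocalizedPoly {
  localized_val : K;
  _ : localized_val \in is_localized }.

HB.instance Definition _ := [isSub for localized_val].
HB.instance Definition _ := [Choice of localized_poly by <:].
HB.instance Definition _ :=
  [SubChoice_isSubComNzRing of localized_poly by <:].

Lemma localized_scale_subproof (c : F) (u : localized_poly) :
  c%:P%:F * val u \in is_localized.
Proof.
have /is_localizedP[h [n ->]] := valP u.
by apply/is_localizedP; exists (c%:P * h), n; rewrite (tofracM c%:P) mulrA.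
Qed.

Definition localized_scale (c : F) (u : localized_poly) : localized_poly :=
  LocalizedPoly (localized_scale_subproof c u).

Lemma localized_scaleA c d u :
  localized_scale c (localized_scale d u) = localized_scale (c * d) u.
Proof. by apply: val_inj; rewrite /= polyCM tofracM mulrA. Qed.

Lemma localized_scale1 : left_id 1 localized_scale.
Proof. by move=> u; apply: val_inj; rewrite /= polyC1 tofrac1 mul1r. Qed.

Lemma localized_scaleDr : right_distributive localized_scale +%R.
Proof. by move=> c u v; apply: val_inj; rewrite /= mulrDr. Qed.

Lemma localized_scaleDl u : {morph localized_scale^~ u : c d / c + d}.
Proof. by move=> c d; apply: val_inj; rewrite /= polyCD tofracD mulrDl. Qed.

HB.instance Definition _ := GRing.Zmodule_isLmodule.Build F localized_poly
  localized_scaleA localized_scale1 localized_scaleDr localized_scaleDl.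

Lemma localized_scaleAl (c : F) (u v : localized_poly) :
  c *: (u * v) = (c *: u) * v.
Proof. by apply: val_inj; rewrite /= mulrA. Qed.

HB.instance Definition _ :=
  GRing.Lmodule_isLalgebra.Build F localized_poly localized_scaleAl.
HB.instance Definition _ :=
  GRing.Lalgebra_isComAlgebra.Build F localized_poly.

Lemma localized_of_poly_subproof (h : {poly F}) : h%:F \in is_localized.
Proof. by apply/is_localizedP; exists h, 0%N; rewrite expr0 divr1. Qed.

Definition localized_of_poly (h : {poly F}) : localized_poly :=
  LocalizedPoly (localized_of_poly_subproof h).

Hypothesis g_neq0 : g != 0.

Lemma localized_unit_subproof (m n : int) :
  ('X%:F : K) ^ m * (g%:F : K) ^ n \in is_localized.
Proof.
have X_neq0 : ('X%:F : K) != 0 by rewrite tofrac_eq0 polyX_eq0.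
have gF_neq0 : (g%:F : K) != 0 by rewrite tofrac_eq0.
have polyl := localized_of_poly_subproof.
have XV : ('X%:F : K)^-1 \in is_localized.
  apply/is_localizedP; exists g, 1%N.
  by rewrite expr1 tofracM invfM mulrCA (divff gF_neq0) mulr1.
have gV : (g%:F : K)^-1 \in is_localized.
  apply/is_localizedP; exists 'X, 1%N.
  by rewrite expr1 tofracM invfM mulrA (divff X_neq0) mul1r.
have powl (u : K) (k : int) :
    u \in is_localized -> u^-1 \in is_localized -> u ^ k \in is_localized.
  by case: k => k uP uVP; rewrite ?NegzE -?exprz_inv ?exprzN rpredX.
by rewrite rpredM // powl.
Qed.

(* x ^ m * g(x) ^ n, with m and n possibly negative *)
Definition localized_unit (m n : int) : localized_poly :=
  LocalizedPoly (localized_unit_subproof m n).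

Lemma localized_unit0 : localized_unit 0 0 = 1.
Proof. by apply: val_inj; rewrite /= !expr0z mulr1. Qed.

Lemma localized_unitD m n m' n' :
  localized_unit (m + m') (n + n') = localized_unit m n * localized_unit m' n'.
Proof.
apply: val_inj; rewrite /= !expfzDr ?tofrac_eq0 ?polyX_eq0 //.
by rewrite mulrACA.
Qed.

Lemma localized_unit10 : localized_unit 1 0 = localized_of_poly 'X.
Proof. by apply: val_inj; rewrite /= expr1z expr0z mulr1. Qed.

Lemma localized_unit01 : localized_unit 0 1 = localized_of_poly g.
Proof. by apply: val_inj; rewrite /= expr1z expr0z mul1r. Qed.

End LocalizedPoly.

Section Lamplighter.
Variables (p d : nat) (g : {poly 'F_p}) (g_neq0 : g != 0).

Definition Atilde := tensor_power (localized_poly g) 'I_d.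

(* The polynomial h(x_i), i.e. h in the i-th tensor factor and 1 elsewhere. *)
Definition poly_at (i : 'I_d) (h : {poly 'F_p}) : Atilde :=
  pure (upd 1 i (localized_of_poly g h)).

(* q.1 i and q.2 i are the exponents of x_i and y_i respectively. *)
Definition Qtilde : zmodType :=
  ({ffun 'I_d -> int} * {ffun 'I_d -> int})%type.

Definition Qx (i : 'I_d) : Qtilde := ([ffun j => (j == i)%:Z], 0).
Definition Qy (i : 'I_d) : Qtilde := (0, [ffun j => (j == i)%:Z]).

(* Multiplication by the product over i of x_i ^ q.1 i * g(x_i) ^ q.2 i. *)
Definition Qmul (q : Qtilde) (a : Atilde) : Atilde :=
  pure [ffun i => localized_unit g_neq0 (q.1 i) (q.2 i)] * a.

Lemma Qmul_add q : {morph Qmul q : a b / a + b}.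
Proof. by move=> a b; rewrite /Qmul mulrDr. Qed.

Lemma Qmul0 a : Qmul 0 a = a.
Proof.
rewrite /Qmul -[RHS]mul1r -pure1; congr (pure _ * _).
by apply/ffunP => i; rewrite !ffunE localized_unit0.
Qed.

Lemma QmulD q r a : Qmul (q + r) a = Qmul q (Qmul r a).
Proof.
rewrite /Qmul mulrA -pureM; congr (pure _ * _).
by apply/ffunP => i; rewrite !ffunE localized_unitD.
Qed.

Lemma QmulX i a : Qmul (Qx i) a = poly_at i 'X * a.
Proof.
congr (pure _ * _); apply/ffunP => j; rewrite !ffunE /=.
by case: (j == i); rewrite ?localized_unit10 ?localized_unit0.
Qed.

Lemma QmulY i a : Qmul (Qy i) a = poly_at i g * a.
Proof.
congr (pure _ * _); apply/ffunP => j; rewrite !ffunE /=.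
by case: (j == i); rewrite ?localized_unit01 ?localized_unit0.
Qed.

Definition Qaction : zmod_action Qtilde Atilde :=
  ZmodAction Qmul_add Qmul0 QmulD.

Definition Gtilde : groupType := sdprod Qaction.

End Lamplighter.

Lemma nonmonomial_neq0 (F : fieldType) (g : {poly F}) :
  (forall (c : F) (j : nat), g <> c *: 'X^j) -> g != 0.
Proof. by move=> gP; apply/eqP => g0; apply: (gP 0 0%N); rewrite scale0r. Qed.

(* Main.v *)
From HB Require Import structures.
Require Import Defs.
From mathcomp Require Import all_boot all_order all_algebra.
From mathcomp Require Import finfield boolp.

Set Implicit Arguments.
Unset Strict Implicit.
Unset Printing Implicit Defensive.

Import GRing.Theory.
Local Open Scope ring_scope.

(** A group G is transitive self-similar as soon as it has a subgroup H of
    finite index and a homomorphism f : H -> G (a virtual endomorphism) whose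
    core is trivial: the only normal subgroup K of G with K inside H and f(K)
    inside K is 1. The group then acts on the tree of words over the coset
    space G/H, the state of x at the coset of t being f(t'^-1 x t), where t' is
    the chosen representative of the coset of x t; the kernel of this action is
    contained in the core (self_similar_of_virtual_endo).

    For d = 1 one could divide by x - 1 on the ideal (x - 1), but for d > 1 no
    proper principal ideal has finite index in Atilde. The characteristic p
    gives another map: the Cartier operator C, which is additive, satisfies
    C(a^p b) = a C(b), and sends a monomial x^k to x^(k/p) if p divides all the
    exponents and to 0 otherwise. The action of p q on Atilde is multiplication
    by the p-th power of a unit u, where q acts as multiplication by u; hence
    C (p q . b) = q . C b, and (b, p q) |-> (C b, q) is a homomorphism on
    Atilde x| p Qtilde. It is restricted to H = I x| p Qtilde, where I is the
    kernel of the evaluation at x_1 = ... = x_d = 1. This evaluation exists on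
    Atilde because x - 1 does not divide g, and its kernel has index p.

    The core is trivial for two reasons. The Qtilde-components of its elements
    are divisible by every power of p, hence vanish (virtual_endo_core). And a
    Qtilde-submodule N of Atilde that is stable under C and contained in I is
    zero (invariant_submodule_eq0): given a in N, multiply it by a power of the
    x_i g(x_i) to turn it into a sum of the c_e x^e with all 0 <= e_i < p^n;
    then C^n applied to x^(p^n - e) a is c_e x_1 ... x_d, whose value at 1 is
    c_e, so that every c_e is 0. *)

(** * Self-similarity from a virtual endomorphism *)

(** Here c is the projection of G onto the left cosets of H = c^-1 (c 1), t is a
    transversal, and f is a total function of which only the restriction to H
    matters. *)
Section VirtualEndomorphism.
Local Open Scope group_scope.
Variables (G : groupType) (k : nat) (c : G -> 'I_k) (t : 'I_k -> G).
Variable f : G -> G.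
Hypothesis tK : cancel t c.
Hypothesis cosetP : forall x y, c x = c y <-> c (x^-1 * y) = c 1.
Hypothesis fM :
  forall x y, c x = c 1 -> c y = c 1 -> f (x * y) = f x * f y.

Implicit Types (x y z : G) (i : 'I_k) (w : seq 'I_k).

Lemma coset_mul x y z : c y = c z -> c (x * y) = c (x * z).
Proof.
by move/cosetP=> yz; apply: (cosetP _ _).2; rewrite invgM mulgA mulgVK.
Qed.

(** The H-part of x * t i, relative to the representative of its coset. *)
Definition coset_cocycle x i : G := (t (c (x * t i)))^-1 * x * t i.

Lemma cocycle_stab x i : c (coset_cocycle x i) = c 1.
Proof.
by rewrite /coset_cocycle -mulgA; apply: (cosetP _ _).1; rewrite tK.
Qed.

Lemma coset_act_mul x y i : c (x * y * t i) = c (x * t (c (y * t i))).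
Proof. by rewrite -mulgA; apply: coset_mul; rewrite tK. Qed.

Lemma cocycle_mul x y i :
  coset_cocycle (x * y) i = coset_cocycle x (c (y * t i)) * coset_cocycle y i.
Proof. by rewrite /coset_cocycle coset_act_mul !mulgA mulgK. Qed.

Fixpoint word_act x w : seq 'I_k :=
  if w is i :: w' then c (x * t i) :: word_act (f (coset_cocycle x i)) w'
  else [::].

Lemma word_act1 : word_act 1 =1 id.
Proof.
have f1 : f 1 = 1 by apply: (mulgI (f 1)); rewrite -fM // !mulg1.
by elim=> //= i w IHw; rewrite /coset_cocycle !mul1g tK mulg1 mulVg f1 IHw.
Qed.

Lemma word_actM x y w : word_act (x * y) w = word_act x (word_act y w).
Proof.
elim: w x y => //= i w IHw x y.
by rewrite cocycle_mul fM ?cocycle_stab // coset_act_mul IHw.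
Qed.

Lemma word_act_tree_aut x : `[< is_tree_aut (word_act x) >].
Proof.
apply/asboolP; split.
- by exists (word_act x^-1) => w; rewrite -word_actM ?mulVg ?mulgV word_act1.
- by move=> w; elim: w x => //= i w IHw x; rewrite IHw.
- move=> v w; elim: v w x => [|i v IHv] [|j w] //= x.
  by move=> /andP[/eqP-> vw]; rewrite eqxx IHv.
Qed.

Definition tree_rep x : tree_aut k := TreeAut (word_act_tree_aut x).

Lemma tree_repM : {morph tree_rep : x y / x * y}.
Proof. by move=> x y; apply: tree_aut_eq => w; apply: word_actM. Qed.

HB.instance Definition _ :=
  isMultiplicative.Build G (tree_aut k) tree_rep tree_repM.

Lemma state_tree_rep x i :
  state (tree_rep x) i = tree_rep (f (coset_cocycle x i)).
Proof. exact: tree_aut_eq. Qed.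

(** The kernel of the action is a conjugation-invariant set inside H that f
    preserves: if x acts trivially then so does u = t i * x * (t i)^-1, and the
    state of u at i is f x. *)
Lemma self_similar_of_virtual_endo_ord :
  (forall K : G -> Prop,
     (forall x y, K x -> K (y * x * y^-1)) ->
     (forall x, K x -> c x = c 1 /\ K (f x)) ->
     forall x, K x -> x = 1) ->
  transitive_self_similar G.
Proof.
move=> core; exists k; split; first exact: leq_ltn_trans (ltn_ord (c 1)).
pose H : {pred tree_aut k} := [pred h | `[< exists x, tree_rep x = h >]].
have HP h : h \in H <-> exists x, tree_rep x = h by split=> /asboolP.
have rep1 : tree_rep 1 = 1 by apply: tree_aut_eq => w; apply: word_act1.
have repV x : tree_rep x^-1 = (tree_rep x)^-1.
  by apply: (mulgI (tree_rep x)); rewrite -tree_repM !mulgV.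
exists H; split.
- split; first by apply/HP; exists 1.
  move=> _ _ /HP[x <-] /HP[y <-]; apply/HP; exists (x * y^-1).
  by rewrite tree_repM repV.
- by move=> _ /HP[x <-] i; apply/HP; eexists; symmetry; apply: state_tree_rep.
- move=> i j; exists (tree_rep (t j * (t i)^-1)); first by apply/HP; eexists.
  by rewrite /= mulgVK tK.
exists tree_rep; split=> // x y xy; apply: divg1_eq.
have conj_id z u : word_act z =1 id -> word_act (u * z * u^-1) =1 id.
  by move=> zid w; rewrite !word_actM zid -word_actM mulgV word_act1.
apply: (core (fun z => word_act z =1 id)) => [z u zid|z zid|w].
- exact: conj_id.
- pose i := c 1; have uid := conj_id z (t i) zid.
  have ui : c (t i * z * (t i)^-1 * t i) = i by have [] := uid [:: i].
  have uz : coset_cocycle (t i * z * (t i)^-1) i = z.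
    by rewrite /coset_cocycle ui !mulgA mulVg mul1g mulgVK.
  split; first by rewrite -uz cocycle_stab.
  by move=> w; rewrite -uz; have [] := uid (i :: w).
- rewrite -[RHS]word_act1 -(mulgV y) !word_actM.
  by rewrite -[word_act x _]/(tree_rep x _) xy.
Qed.

End VirtualEndomorphism.

(** The core is tested on conjugation-invariant subsets; this is no stronger
    than testing normal subgroups, since the subgroup generated by such a subset
    is normal and inherits the other two properties. *)
Lemma self_similar_of_virtual_endo (G : groupType) (T : finType)
    (c : G -> T) (t : T -> G) (f : G -> G) :
  cancel t c ->
  (forall x y, c x = c y <-> c (x^-1 * y)%g = c 1%g) ->
  (forall x y, c x = c 1%g -> c y = c 1%g -> f (x * y)%g = (f x * f y)%g) ->
  (forall K : G -> Prop,
     (forall x y, K x -> K (y * x * y^-1)%g) ->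
     (forall x, K x -> c x = c 1%g /\ K (f x)) ->
     forall x, K x -> x = 1%g) ->
  transitive_self_similar G.
Proof.
move=> tK cP fM core.
pose c' x := enum_rank (c x); pose t' (i : 'I_#|T|) := t (enum_val i).
have c'E x y : c' x = c' y <-> c x = c y.
  by split=> [/enum_rank_inj|/(congr1 enum_rank)].
apply: (@self_similar_of_virtual_endo_ord G _ c' t' f).
- by move=> i; rewrite /c' /t' tK enum_valK.
- by move=> x y; rewrite !c'E.
- by move=> x y /c'E cx /c'E; apply: fM.
- by move=> K KJ KH; apply: core => // x /KH[/c'E].
Qed.

(** * Linear functions *)

Section LinearFunctions.
Variables (R : pzRingType) (U V : lmodType R) (f : U -> V).
Hypothesis f_lin : linear f.

Lemma linear_fun0 : f 0 = 0.
Proof. by have := f_lin (-1) 0 0; rewrite !scaleN1r oppr0 addr0 addNr. Qed.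

Lemma linear_funZ (c : R) (u : U) : f (c *: u) = c *: f u.
Proof. by rewrite -[c *: u]addr0 f_lin linear_fun0 addr0. Qed.

Lemma linear_fun_sum (J : finType) (c : J -> R) (u : J -> U) :
  f (\sum_j c j *: u j) = \sum_j c j *: f (u j).
Proof.
elim/big_rec2: _ => [|j y z _ <-]; first exact: linear_fun0.
exact: f_lin.
Qed.

End LinearFunctions.

Lemma linear_poly_coef (F : fieldType) (V : lmodType F) (f : {poly F} -> V)
    (h : {poly F}) m :
  linear f -> (size h <= m)%N -> f h = \sum_(j < m) h`_j *: f 'X^j.
Proof.
move=> f_lin hm; rewrite -(linear_fun_sum f_lin); congr f.
rewrite -poly_def; apply/polyP=> j; rewrite coef_poly; case: ltnP => // mj.
by rewrite nth_default // (leq_trans hm).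
Qed.

(** * Extending maps from polynomials to their localization *)

Section LocalizedMaps.
Variables (F : fieldType) (g : {poly F}) (g_neq0 : g != 0).
Local Notation L := (localized_poly g).
Local Notation s := ('X * g : {poly F}).
Local Notation iota := (localized_of_poly g).

Lemma localized_of_poly_inj : injective iota.
Proof. by move=> a b /(congr1 val)/eqP; rewrite tofrac_eq => /eqP. Qed.

Lemma localized_of_poly_is_zmod_morphism : zmod_morphism iota.
Proof. by move=> a b; apply: val_inj; rewrite /= tofracB. Qed.

Lemma localized_of_poly_is_monoid_morphism : monoid_morphism iota.
Proof.
by split=> [|a b]; apply: val_inj; rewrite /= ?tofrac1 ?tofracM.
Qed.

HB.instance Definition _ := GRing.isZmodMorphism.Build {poly F} L iota
  localized_of_poly_is_zmod_morphism.
HB.instance Definition _ := GRing.isMonoidMorphism.Build {poly F} L iota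
  localized_of_poly_is_monoid_morphism.

Lemma localized_of_poly_linear : linear iota.
Proof.
by move=> c a b; apply: val_inj; rewrite /= -mul_polyC tofracD tofracM.
Qed.

Lemma clear_denominators (u : L) :
  exists nh : nat * {poly F}, u * iota s ^+ nh.1 = iota nh.2.
Proof.
have /is_localizedP[h [n uE]] := valP u; exists (n, h); apply: val_inj.
rewrite rmorphM rmorphXn /= -/(val u) uE divfK // expf_neq0 //.
by rewrite tofrac_eq0 mulf_neq0 ?polyX_eq0.
Qed.

Definition denom_exp (u : L) : nat := (projT1 (cid (clear_denominators u))).1.
Definition numer (u : L) : {poly F} := (projT1 (cid (clear_denominators u))).2.

Lemma numerP (u : L) : u * iota s ^+ denom_exp u = iota (numer u).
Proof. by rewrite /denom_exp /numer; case: cid. Qed.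

Lemma clear_denominators_ge (u : L) N :
  (denom_exp u <= N)%N -> exists h, u * iota s ^+ N = iota h.
Proof.
move=> /subnK <-; exists (s ^+ (N - denom_exp u) * numer u).
by rewrite exprD mulrCA numerP (rmorphM _ (s ^+ _)) rmorphXn.
Qed.

(** A map psi on polynomials that pulls k-th powers out through sigma extends to
    fractions: write the denominator as a k-th power s ^ (k n) and divide the
    value of psi on the numerator by sigma s ^ n, where t inverts sigma s. With
    k = 1 this extends ring morphisms, and with k = p the Cartier operator. *)
Section Extend.
Variables (V : comAlgType F) (psi sigma : {poly F} -> V) (k : nat) (t : V).
Hypothesis psi_linear : linear psi.
Hypothesis k_gt0 : (0 < k)%N.
Hypothesis psi_semi : forall a h, psi (a ^+ k * h) = sigma a * psi h.
Hypothesis tK : sigma s * t = 1.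

Definition localized_extend (u : L) : V :=
  t ^+ denom_exp u * psi (s ^+ (k.-1 * denom_exp u) * numer u).

Lemma psi_sX n h : psi (s ^+ (k * n) * h) = sigma s ^+ n * psi h.
Proof.
elim: n => [|n IHn]; first by rewrite muln0 !expr0 !mul1r.
by rewrite mulnS exprD -mulrA psi_semi IHn exprS mulrA.
Qed.

(** The value is independent of the representation of u as a fraction. *)
Lemma localized_extendE u n h : u * iota s ^+ (k * n) = iota h ->
  localized_extend u = t ^+ n * psi h.
Proof.
move=> uh; rewrite /localized_extend; set m := denom_exp u.
set h' := _ * numer u.
have uh' : u * iota s ^+ (k * m) = iota h'.
  rewrite /h' (rmorphM _ (s ^+ _)) rmorphXn /= -(numerP u) -/m mulrCA -exprD.
  by congr (_ * _ ^+ _); rewrite -[k in LHS](prednK k_gt0) mulSn addnC.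
clearbody h'; have {uh uh'} hh' : s ^+ (k * m) * h = s ^+ (k * n) * h'.
  apply: localized_of_poly_inj; rewrite !(rmorphM _ (s ^+ _)) !rmorphXn /=.
  by rewrite -uh -uh' mulrCA -!exprD mulrCA -exprD addnC.
have tX i : sigma s ^+ i * t ^+ i = 1 by rewrite -exprMn tK expr1n.
rewrite -[psi h']mul1r -(tX n) [sigma s ^+ n * _]mulrC -mulrA -psi_sX -hh'.
by rewrite psi_sX mulrCA [t ^+ m * _]mulrA [t ^+ m * _]mulrC tX mul1r.
Qed.

Lemma localized_extend_linear : linear localized_extend.
Proof.
move=> a u v; pose n := maxn (denom_exp u) (denom_exp v).
have le_kn w : (denom_exp w <= n)%N -> (denom_exp w <= k * n)%N.
  by move=> wn; rewrite (leq_trans wn) // leq_pmull.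
have [|h uh] := @clear_denominators_ge u (k * n).
  by rewrite le_kn ?leq_maxl.
have [|l vl] := @clear_denominators_ge v (k * n).
  by rewrite le_kn ?leq_maxr.
rewrite (localized_extendE uh) (localized_extendE vl).
have -> : localized_extend (a *: u + v) = t ^+ n * psi (a *: h + l).
  apply: localized_extendE.
  by rewrite mulrDl -scalerAl uh vl localized_of_poly_linear.
by rewrite psi_linear mulrDr scalerAr.
Qed.

Lemma localized_extend_poly h : localized_extend (iota h) = psi h.
Proof.
by rewrite (@localized_extendE _ 0 h) ?muln0 ?expr0 ?mulr1 ?mul1r.
Qed.

Lemma localized_extend_semi u v N a : u * iota s ^+ N = iota a ->
  localized_extend (u ^+ k * v) = t ^+ N * sigma a * localized_extend v.
Proof.
move=> ua; have [|h vh] := @clear_denominators_ge v (k * denom_exp v).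
  exact: leq_pmull.
rewrite (@localized_extendE _ (N + denom_exp v) (a ^+ k * h)).
  by rewrite (localized_extendE vh) psi_semi exprD mulrACA.
rewrite (rmorphM _ (a ^+ _)) rmorphXn /= -ua -vh exprMn -exprM mulnDr exprD.
by rewrite [(N * k)%N]mulnC mulrACA.
Qed.

End Extend.

Section Evaluation.
Variable x : F.
Hypothesis sx_neq0 : s.[x] != 0.

Definition localized_eval : L -> F^o :=
  @localized_extend F^o (fun h => h.[x]) 1 (s.[x]^-1 : F).

Let horner_linear : linear (fun h : {poly F} => h.[x] : F^o).
Proof. by move=> a h l; rewrite hornerD hornerZ. Qed.

Let horner_semi a h : (a ^+ 1 * h).[x] = a.[x] * h.[x].
Proof. by rewrite expr1 hornerM. Qed.

Let sxK : s.[x] * s.[x]^-1 = 1.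
Proof. exact: divff. Qed.

Lemma localized_eval_linear : linear localized_eval.
Proof.
exact: (@localized_extend_linear F^o _ _ 1 _ horner_linear _ horner_semi sxK).
Qed.

Lemma localized_eval_poly h : localized_eval (iota h) = h.[x].
Proof. exact: (@localized_extend_poly F^o _ _ 1 _ _ horner_semi sxK). Qed.

Lemma localized_evalM u v :
  localized_eval (u * v) = localized_eval u * localized_eval v.
Proof.
have ua := numerP u; rewrite /localized_eval -[u in LHS]expr1.
rewrite (@localized_extend_semi F^o _ _ 1 _ _ horner_semi sxK _ _ _ _ ua) //.
congr (_ * _); symmetry.
apply: (@localized_extendE F^o _ _ 1 _ _ horner_semi sxK) => //.
by rewrite mul1n.
Qed.

End Evaluation.
End LocalizedMaps.

(** * The Cartier operator in one variable *)

Section Cartier.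
Variables (p : nat) (p_prime : prime p).
Implicit Types a h : {poly 'F_p}.

(** The Cartier operator keeps the exponents divisible by p and divides them by
    p; the coefficients need no p-th root over the prime field. *)
Definition cartier_poly h : {poly 'F_p} := \poly_(i < size h) h`_(p * i).

Lemma coef_cartier_poly h i : (cartier_poly h)`_i = h`_(p * i).
Proof.
rewrite coef_poly; case: ltnP => // le_hi; rewrite nth_default //.
by rewrite (leq_trans le_hi) // leq_pmull // prime_gt0.
Qed.

Lemma cartier_poly_linear : linear cartier_poly.
Proof.
by move=> c a h; apply/polyP=> i; rewrite !(coefD, coefZ, coef_cartier_poly).
Qed.

(** By additivity of Frobenius in a, it suffices to treat a constant c, where
    c ^ p = c, and the factor 'X, where it is a shift of the coefficients. *)
Lemma cartier_poly_semi a h : cartier_poly (a ^+ p * h) = a * cartier_poly h.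
Proof.
have pcharP : [pchar {poly 'F_p}].-nat p.
  by rewrite pnatE // pchar_poly; apply: pchar_Fp.
elim/poly_ind: a h => [|a c IHa] h.
  rewrite expr0n gtn_eqF ?prime_gt0 // !mul0r.
  exact: linear_fun0 cartier_poly_linear.
have cp : c ^+ p = c by rewrite -[p in _ ^+ p](card_Fp p_prime) expf_card.
rewrite exprDn_pchar // !mulrDl -[_ ^+ p * h]scale1r cartier_poly_linear.
rewrite scale1r exprMn -polyC_exp cp -!mulrA IHa.
congr (a * _ + _); apply/polyP=> i; last first.
  by rewrite !(mul_polyC, coefZ, coef_cartier_poly).
rewrite coefXM !coef_cartier_poly coefXnM; case: i => [|i].
  by rewrite muln0 prime_gt0.
by rewrite ltnNge mulnS leq_addr addKn.
Qed.

Lemma coef_iter_cartier_poly n h i :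
  (iter n cartier_poly h)`_i = h`_(p ^ n * i).
Proof.
elim: n i => [|n IHn] i /=; first by rewrite mul1n.
by rewrite coef_cartier_poly IHn mulnA expnSr.
Qed.

Lemma iter_cartier_Xn n m : (0 < m < 2 * p ^ n)%N ->
  iter n cartier_poly 'X^m = 'X *+ (m == p ^ n)%N.
Proof.
move=> /andP[m_gt0 m_lt]; apply/polyP=> i.
rewrite coef_iter_cartier_poly coefXn coefMn coefX -mulrnA mulnb.
congr (_%:R); congr nat_of_bool; apply/eqP/andP=> [im|[/eqP-> /eqP->]].
  suff i1 : i = 1%N by rewrite -im i1 muln1 !eqxx.
  have pn_gt0 : (0 < p ^ n)%N by rewrite expn_gt0 prime_gt0.
  case: i im => [|[|i]] im //; first by rewrite -im muln0 in m_gt0.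
  by rewrite -im mulnC ltn_pmul2r in m_lt.
by rewrite muln1.
Qed.

Variables (g : {poly 'F_p}) (g_neq0 : g != 0).
Local Notation L := (localized_poly g).
Local Notation iota := (localized_of_poly g).

Definition cartier : L -> L :=
  localized_extend g_neq0 (fun h => iota (cartier_poly h)) p
    (localized_unit g_neq0 (-1) (-1)).

Let iota_cartier_linear : linear (fun h => iota (cartier_poly h)).
Proof.
by move=> c a h; rewrite cartier_poly_linear localized_of_poly_linear.
Qed.

Let iota_cartier_semi a h :
  iota (cartier_poly (a ^+ p * h)) = iota a * iota (cartier_poly h).
Proof. by rewrite cartier_poly_semi rmorphM. Qed.

Let iota_sK : iota ('X * g) * localized_unit g_neq0 (-1) (-1) = 1.
Proof.
rewrite rmorphM /= -(localized_unit10 g_neq0) -(localized_unit01 g_neq0).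
by rewrite -!localized_unitD localized_unit0.
Qed.

Lemma cartier_linear : linear cartier.
Proof.
exact: localized_extend_linear iota_cartier_linear (prime_gt0 p_prime)
  iota_cartier_semi iota_sK.
Qed.

Lemma cartier_of_poly h : cartier (iota h) = iota (cartier_poly h).
Proof.
exact: localized_extend_poly (prime_gt0 p_prime) iota_cartier_semi iota_sK _.
Qed.

Lemma cartier_semi u v : cartier (u ^+ p * v) = u * cartier v.
Proof.
have ua := numerP g_neq0 u; rewrite /cartier.
rewrite (localized_extend_semi g_neq0 (prime_gt0 p_prime) iota_cartier_semi
  iota_sK _ ua).
rewrite -ua [_ ^+ _ * (u * _)]mulrCA -exprMn [_ * iota _]mulrC iota_sK.
by rewrite expr1n mulr1.
Qed.

Lemma cartier_unit m n u :
  cartier (localized_unit g_neq0 (p%:Z * m) (p%:Z * n) * u) =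
  localized_unit g_neq0 m n * cartier u.
Proof.
rewrite -cartier_semi; congr (cartier (_ * _)).
have unitX k : localized_unit g_neq0 (k%:Z * m) (k%:Z * n) =
    localized_unit g_neq0 m n ^+ k.
  elim: k => [|k IHk]; first by rewrite !mul0r localized_unit0.
  by rewrite exprS -IHk -localized_unitD -add1n PoszD !mulrDl !mul1r.
exact: unitX.
Qed.

End Cartier.

(** * Maps on tensor powers *)

Section TensorPowerMaps.
Variables (R : comNzRingType) (B : comAlgType R) (I : finType).
Local Notation T := (tensor_power B I).
Implicit Types (b : {ffun I -> B}) (x y : T).

Lemma tensor_ind (P : T -> Prop) :
  P 0 -> (forall c b x, P x -> P (c *: pure b + x)) -> forall x, P x.
Proof.
move=> P0 PD x; rewrite [x]tensor_repr_sum.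
by elim: (tensor_repr x) => [|u s IHs]; rewrite ?big_nil // big_cons; apply: PD.
Qed.

Lemma tensor_lift_linear (W : lmodType R) (m : {ffun I -> B} -> W) :
  multilinear m -> linear (tensor_lift m).
Proof. by move=> mP c x y; rewrite [LHS]liftD // liftZ. Qed.

Section Map.
Variable phi : B -> B.
Hypothesis phi_lin : linear phi.

Definition tensor_map : T -> T :=
  tensor_lift (fun b => pure [ffun i => phi (b i)]).

Lemma tensor_map_multilinear :
  multilinear (fun b : {ffun I -> B} => pure [ffun i => phi (b i)]).
Proof.
move=> b i c x y; have phi_upd z :
    [ffun j => phi (upd b i z j)] = upd [ffun j => phi (b j)] i (phi z).
  by apply/ffunP=> j; rewrite !ffunE; case: eqP.
by rewrite !phi_upd phi_lin pure_multilinear.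
Qed.

Lemma tensor_map_linear : linear tensor_map.
Proof. exact: tensor_lift_linear tensor_map_multilinear. Qed.

Lemma tensor_map_pure b : tensor_map (pure b) = pure [ffun i => phi (b i)].
Proof. exact: lift_pure tensor_map_multilinear. Qed.

Lemma tensor_map_semi b b' : (forall i u, phi (b i * u) = b' i * phi u) ->
  forall x, tensor_map (pure b * x) = pure b' * tensor_map x.
Proof.
move=> bb'; have f0 := linear_fun0 tensor_map_linear.
elim/tensor_ind=> [|c a x IHx]; first by rewrite mulr0 f0 mulr0.
rewrite mulrDr mulrC -tensor_scaleAl mulrC -pureM !tensor_map_linear IHx.
rewrite mulrDr !tensor_map_pure; congr (_ + _).
rewrite [RHS]mulrC -tensor_scaleAl; congr (_ *: _); rewrite mulrC -pureM.
by congr (pure _); apply/ffunP=> i; rewrite !ffunE bb'.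
Qed.

End Map.

Section Eval.
Variable ev : B -> R^o.
Hypothesis ev_lin : linear ev.
Hypothesis evM : forall u v, ev (u * v) = ev u * ev v.

Definition tensor_eval : T -> R^o := tensor_lift (fun b => \prod_i ev (b i)).

Lemma tensor_eval_multilinear :
  multilinear (fun b : {ffun I -> B} => (\prod_i ev (b i) : R^o)).
Proof.
move=> b i c x y.
have prodE z : \prod_j ev (upd b i z j) = ev z * \prod_(j | j != i) ev (b j).
  rewrite (bigD1 i) //= ffunE eqxx; congr (_ * _).
  by apply: eq_bigr => j /negPf ji; rewrite ffunE ji.
by rewrite !prodE ev_lin mulrDl scalerAl.
Qed.

Lemma tensor_eval_linear : linear tensor_eval.
Proof. exact: tensor_lift_linear tensor_eval_multilinear. Qed.

Lemma tensor_eval_pure b : tensor_eval (pure b) = \prod_i ev (b i).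
Proof. exact: lift_pure tensor_eval_multilinear. Qed.

Lemma tensor_eval_pureM b x :
  tensor_eval (pure b * x) = (\prod_i ev (b i)) * tensor_eval x.
Proof.
have f0 := linear_fun0 tensor_eval_linear.
elim/tensor_ind: x => [|c a x IHx]; first by rewrite mulr0 f0 mulr0.
rewrite mulrDr mulrC -tensor_scaleAl mulrC -pureM !tensor_eval_linear IHx.
rewrite mulrDr !tensor_eval_pure -scalerAr; congr (_ + _).
congr (_ *: _); rewrite -big_split /=.
by apply: eq_bigr => i _; rewrite ffunE evM.
Qed.

End Eval.

Lemma pure_prod b : pure b = \prod_i pure (upd 1 i (b i)).
Proof.
rewrite -(big_morph (@pure R B I) (@pureM R B I) (pure1 B I)); congr (pure _).
apply/ffunP=> j.
have -> (r : seq I) (F : I -> {ffun I -> B}) :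
    (\prod_(i <- r) F i) j = \prod_(i <- r) F i j.
  by elim: r => [|i r IHr]; rewrite ?big_nil ?big_cons ffunE ?IHr.
rewrite (bigD1 j) //= big1 ?mulr1 => [|i ji]; rewrite !ffunE ?eqxx //.
by rewrite eq_sym (negPf ji).
Qed.

(** Full expansion of a pure tensor of linear combinations. As a product of
    one-factor tensors, which are linear in that factor, it is an instance of
    the distributivity of products over sums. *)
Lemma pure_sum m (c : I -> 'I_m -> R) (u : 'I_m -> B) :
  pure [ffun i => \sum_j c i j *: u j] =
  \sum_(e : {ffun I -> 'I_m}) (\prod_i c i (e i)) *: pure [ffun i => u (e i)].
Proof.
have at_lin (i : I) : linear (fun v : B => pure (upd 1 i v) : T).
  by move=> a v w; rewrite pure_multilinear.
rewrite pure_prod; under eq_bigr => i _.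
  rewrite ffunE (linear_fun_sum (at_lin i)); over.
rewrite bigA_distr_bigA; apply: eq_bigr => e _ /=.
rewrite [in RHS]pure_prod; elim/big_rec3: _ => [|i x y z _ ->].
  by rewrite scale1r.
by rewrite ffunE -scalerA -tensor_scaleAl mulrC -tensor_scaleAl mulrC.
Qed.

End TensorPowerMaps.

Section MonomialExpansion.
Variables (F : fieldType) (g : {poly F}) (I : finType).
Hypothesis g_neq0 : g != 0.
Local Notation L := (localized_poly g).
Local Notation iota := (localized_of_poly g).

Definition monomial (m : nat) (e : {ffun I -> 'I_m}) : tensor_power L I :=
  pure [ffun i => iota 'X^(e i)].

(** Every tensor becomes a combination of monomials once multiplied by a high
    enough power of the x_i g(x_i). The thresholds N and M make the property
    additive in a: summands can share a power and a degree bound. *)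
Lemma monomial_expansion (a : tensor_power L I) :
  exists N, forall n, (N <= n)%N -> exists M, forall m, (M <= m)%N ->
  exists c : {ffun I -> 'I_m} -> F,
    pure [ffun=> iota ('X * g) ^+ n] * a = \sum_e c e *: monomial e.
Proof.
elim/tensor_ind: a => [|k b a [N IHa]].
  exists 0%N => n _; exists 0%N => m _; exists (fun=> 0).
  by rewrite mulr0 big1 // => e _; rewrite scale0r.
pose Nb := (\max_i denom_exp g_neq0 (b i))%N.
exists (maxn N Nb) => n; rewrite geq_max => /andP[/IHa[M {}IHa] le_n].
have /choice[h hP] i : exists h, b i * iota ('X * g) ^+ n = iota h.
  by apply: clear_denominators_ge; apply: leq_trans (leq_bigmax i) le_n.
exists (maxn M (\max_i size (h i))) => m.
rewrite geq_max => /andP[/IHa[c cP] le_m].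
exists (fun e : {ffun I -> 'I_m} => k * (\prod_i (h i)`_(e i)) + c e).
rewrite mulrDr mulrC -tensor_scaleAl -pureM cP.
under [RHS]eq_bigr do rewrite scalerDl -scalerA.
rewrite big_split -scaler_sumr; congr (_ *: _ + _).
rewrite -(pure_sum (fun i j => (h i)`_j) (fun j => iota 'X^j)); congr (pure _).
apply/ffunP=> i; rewrite !ffunE hP.
have hm : (size (h i) <= m)%N by apply: leq_trans (leq_bigmax i) le_m.
exact: linear_poly_coef (@localized_of_poly_linear F g) hm.
Qed.

End MonomialExpansion.

(** * Submodules stable under the Cartier operator *)

Lemma bigprod_eq0 (R : comPzRingType) (I : finType) (x : I -> R) i :
  x i = 0 -> \prod_j x j = 0.
Proof. by move=> xi0; rewrite (bigD1 i) //= xi0 mul0r. Qed.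

Section InvariantSubmodules.
Variables (p d : nat) (g : {poly 'F_p}).
Hypotheses (p_prime : prime p) (g_neq0 : g != 0) (g1_neq0 : g.[1] != 0).
Local Notation L := (localized_poly g).
Local Notation iota := (localized_of_poly g).
Local Notation A := (Atilde d g).
Implicit Types (a : A) (q : Qtilde d).

Definition cartier_tensor : A -> A := tensor_map (cartier g_neq0).
Definition augmentation : A -> ('F_p)^o :=
  tensor_eval (localized_eval g_neq0 1).

Lemma cartier_tensor_linear : linear cartier_tensor.
Proof. exact/tensor_map_linear/cartier_linear. Qed.

Lemma Xg1_neq0 : ('X * g).[1] != 0.
Proof. by rewrite hornerM hornerX mul1r. Qed.

Lemma eval1_linear : linear (localized_eval g_neq0 1).
Proof. exact: localized_eval_linear Xg1_neq0. Qed.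

Lemma eval1M u v : localized_eval g_neq0 1 (u * v) =
  localized_eval g_neq0 1 u * localized_eval g_neq0 1 v.
Proof. exact: localized_evalM Xg1_neq0 _ _. Qed.

Lemma augmentation_linear : linear augmentation.
Proof. exact: tensor_eval_linear eval1_linear. Qed.

Lemma augmentation_pure (h : 'I_d -> {poly 'F_p}) :
  augmentation (pure [ffun i => iota (h i)]) = \prod_i (h i).[1].
Proof.
rewrite /augmentation (tensor_eval_pure eval1_linear).
by apply: eq_bigr => i _; rewrite ffunE localized_eval_poly ?Xg1_neq0.
Qed.

Lemma augmentation1 : augmentation 1 = 1.
Proof.
rewrite (_ : 1 = pure [ffun i => iota 1]) ?augmentation_pure.
  by rewrite big1 // => i _; rewrite hornerC.
by rewrite -pure1; congr (pure _); apply/ffunP=> i; rewrite !ffunE rmorph1.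
Qed.

Lemma augmentationB a b :
  augmentation (b - a) = augmentation b - augmentation a.
Proof. by rewrite addrC -scaleN1r augmentation_linear scaleN1r addrC. Qed.

Lemma augmentation_Qmul q a :
  (augmentation (Qmul g_neq0 q a) == 0) = (augmentation a == 0).
Proof.
have aug q' a' : augmentation a' = 0 -> augmentation (Qmul g_neq0 q' a') = 0.
  move=> a0; rewrite /augmentation (tensor_eval_pureM eval1_linear eval1M).
  by rewrite -/augmentation -/(augmentation a') a0 mulr0.
apply/eqP/eqP=> [qa0|]; last exact: aug.
by rewrite -[a](Qmul0 g_neq0) -(addNr q) QmulD aug.
Qed.

Definition Qscale q : Qtilde d :=
  ([ffun i => p%:Z * q.1 i], [ffun i => p%:Z * q.2 i]).

Lemma cartier_tensor_Qmul q a :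
  cartier_tensor (Qmul g_neq0 (Qscale q) a) = Qmul g_neq0 q (cartier_tensor a).
Proof.
apply: (tensor_map_semi (cartier_linear p_prime g_neq0)) => i u.
by rewrite !ffunE cartier_unit.
Qed.

Lemma iter_cartier_pure n (J : finType) (c : J -> 'F_p)
    (h : J -> 'I_d -> {poly 'F_p}) :
  iter n cartier_tensor (\sum_j c j *: pure [ffun i => iota (h j i)]) =
  \sum_j c j *: pure [ffun i => iota (iter n (@cartier_poly p) (h j i))].
Proof.
elim: n => //= n ->; rewrite (linear_fun_sum cartier_tensor_linear).
apply: eq_bigr => j _; congr (_ *: _).
rewrite /cartier_tensor (tensor_map_pure (cartier_linear p_prime g_neq0)).
by congr (pure _); apply/ffunP=> i; rewrite !ffunE cartier_of_poly.
Qed.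

Lemma localized_unit_nat m n :
  localized_unit g_neq0 m%:Z n%:Z = iota ('X^m * g ^+ n).
Proof. by apply: val_inj; rewrite /= -!exprnP tofracM !rmorphXn. Qed.

Definition Qdiag (n : nat) : Qtilde d := ([ffun=> n%:Z], [ffun=> n%:Z]).

Lemma Qmul_diag n a :
  Qmul g_neq0 (Qdiag n) a = pure [ffun=> iota ('X * g) ^+ n] * a.
Proof.
congr (pure _ * _); apply/ffunP=> i; rewrite !ffunE.
by rewrite localized_unit_nat -exprMn rmorphXn.
Qed.

Definition Qshift n (e : {ffun 'I_d -> 'I_(p ^ n)}) : Qtilde d :=
  ([ffun i => (p ^ n - e i)%N%:Z], 0).

Lemma Qshift_monomial n (e e' : {ffun 'I_d -> 'I_(p ^ n)}) :
  Qmul g_neq0 (Qshift e) (monomial g e') =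
  pure [ffun i => iota 'X^(p ^ n - e i + e' i)].
Proof.
rewrite /Qmul -pureM; congr (pure _); apply/ffunP=> i; rewrite !ffunE.
by rewrite (localized_unit_nat _ 0) expr0 mulr1 exprD rmorphM.
Qed.

(** The exponents p^n - e_i + e'_i lie strictly between 0 and 2 p^n, so that the
    n-th iterate of the Cartier operator kills all the shifted monomials except
    the one with e' = e, which it sends to x_1 ... x_d. *)
Lemma augmentation_coef n (c : {ffun 'I_d -> 'I_(p ^ n)} -> 'F_p) e :
  augmentation (iter n cartier_tensor
    (Qmul g_neq0 (Qshift e) (\sum_e' c e' *: monomial g e'))) = c e.
Proof.
have -> : Qmul g_neq0 (Qshift e) (\sum_e' c e' *: monomial g e') =
    \sum_e' c e' *: pure [ffun i => iota 'X^(p ^ n - e i + e' i)].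
  rewrite {1}/Qmul mulr_sumr; apply: eq_bigr => e' _.
  by rewrite mulrC -tensor_scaleAl mulrC -Qshift_monomial.
rewrite (iter_cartier_pure n c (fun e' i => 'X^(p ^ n - e i + e' i))).
rewrite (linear_fun_sum augmentation_linear).
rewrite (bigD1 e) //= big1 ?addr0 => [|e' e'_neq].
  rewrite augmentation_pure big1 ?[_ *: _]mulr1 // => i _.
  rewrite subnK ?(ltnW (ltn_ord _)) // iter_cartier_Xn ?eqxx ?hornerX //.
  by rewrite ltn_Pmull ?expn_gt0 ?prime_gt0.
have [i ei] : exists i, e' i != e i.
  apply/existsP; apply: contraR e'_neq; rewrite negb_exists => /forallP ee'.
  by apply/eqP/ffunP=> i; apply/eqP; have := ee' i; rewrite negbK.
rewrite augmentation_pure (@bigprod_eq0 _ _ _ i); first exact: scaler0.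
rewrite iter_cartier_Xn //; last first.
  by rewrite ltn_addr ?subn_gt0 //= mul2n -addnn -addnS leq_add ?leq_subr.
suff /negPf-> : (p ^ n - e i + e' i != p ^ n)%N by rewrite mulr0n horner0.
apply: contraNneq ei => eq_e; apply/eqP/val_inj/eqP.
by rewrite -(eqn_add2l (p ^ n - e i)) eq_e subnK // ltnW.
Qed.

Lemma invariant_submodule_eq0 (N : A -> Prop) :
  (forall q a, N a -> N (Qmul g_neq0 q a)) ->
  (forall a, N a -> augmentation a = 0 /\ N (cartier_tensor a)) ->
  forall a, N a -> a = 0.
Proof.
move=> NQ NC a Na.
have [n0 /(_ _ (leqnn n0))[M aE]] := monomial_expansion g_neq0 a.
have [|c {}aE] := aE (p ^ M)%N; first by rewrite ltnW // ltn_expl // prime_gt1.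
rewrite -[a](Qmul0 g_neq0) -(addNr (Qdiag n0)) QmulD Qmul_diag aE.
rewrite big1 => [|e _]; first by rewrite /Qmul mulr0.
rewrite -(augmentation_coef c e) -aE -Qmul_diag.
have N_iter k b : N b -> N (iter k cartier_tensor b).
  by move=> Nb; elim: k => //= k /NC[].
have Ne := NQ (Qshift e) _ (NQ (Qdiag n0) _ Na).
by have [-> _] := NC _ (N_iter M _ Ne); rewrite scale0r.
Qed.

End InvariantSubmodules.

(** * The virtual endomorphism of Gtilde *)

Section GtildeVirtualEndo.
Variables (p d : nat) (g : {poly 'F_p}).
Hypotheses (p_prime : prime p) (g_neq0 : g != 0) (g1_neq0 : g.[1] != 0).
Local Notation G := (Gtilde d g_neq0).
Local Notation vec := {ffun 'I_d -> 'F_p}.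

Definition mod_p (q : {ffun 'I_d -> int}) : vec := [ffun i => (q i)%:~R].
Definition lift_p (u : vec) : {ffun 'I_d -> int} := [ffun i => (u i : nat)%:Z].
Definition div_p (q : {ffun 'I_d -> int}) : {ffun 'I_d -> int} :=
  [ffun i => (q i %/ p)%Z].

Definition coset_map (x : G) : 'F_p * (vec * vec) :=
  (augmentation g_neq0 x.1, (mod_p x.2.1, mod_p x.2.2)).
Definition transversal (y : 'F_p * (vec * vec)) : G :=
  ((y.1 *: (1 : Atilde d g), (lift_p y.2.1, lift_p y.2.2))
     : Atilde d g * Qtilde d).
Definition virtual_endo (x : G) : G :=
  (cartier_tensor g_neq0 x.1, (div_p x.2.1, div_p x.2.2)).

Lemma transversalK : cancel transversal coset_map.
Proof.
have lift_pK : cancel lift_p mod_p.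
  by move=> u; apply/ffunP=> i; rewrite !ffunE -[RHS]natr_Zp.
case=> [e [u v]]; rewrite /coset_map /= !lift_pK; congr (_, _).
rewrite (linear_funZ (augmentation_linear (d := d) g_neq0 g1_neq0)).
by rewrite augmentation1 // [_ *: _]mulr1.
Qed.

Lemma mod_pB q r : mod_p (r - q) = mod_p r - mod_p q.
Proof. by apply/ffunP=> i; rewrite !ffunE rmorphB. Qed.

Lemma mod_p0P q : mod_p q = 0 <-> q = [ffun i => p%:Z * div_p q i].
Proof.
have pP := pchar_Fp p_prime.
split=> [q0|->]; apply/ffunP=> i; rewrite !ffunE.
  have : (p %| q i)%Z.
    by rewrite (dvdz_pcharf pP); move/ffunP/(_ i): q0; rewrite !ffunE => ->.
  by move/divzK=> {1}<-; rewrite mulrC.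
by apply/eqP; rewrite -(dvdz_pcharf pP) dvdz_mulr.
Qed.

Lemma div_pD q r : mod_p q = 0 -> div_p (q + r) = div_p q + div_p r.
Proof.
move/mod_p0P/ffunP=> qE; apply/ffunP=> i; have := qE i; rewrite !ffunE => qi.
by rewrite {1}qi [_ * _]mulrC divzMDl // eqz_nat -lt0n prime_gt0.
Qed.

Lemma coset_map1 (x : G) : coset_map x = coset_map 1%g <->
  [/\ augmentation g_neq0 x.1 = 0, mod_p x.2.1 = 0 & mod_p x.2.2 = 0].
Proof.
have aug0 := linear_fun0 (augmentation_linear (d := d) g_neq0 g1_neq0).
have mod0 : mod_p 0 = 0 by apply/ffunP=> i; rewrite !ffunE.
by rewrite /coset_map /= aug0 mod0; split=> [[-> -> ->]|[-> -> ->]].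
Qed.

Lemma coset_mapP (x y : G) :
  coset_map x = coset_map y <-> coset_map (x^-1 * y)%g = coset_map 1%g.
Proof.
have augE : augmentation g_neq0 (x^-1 * y)%g.1 = 0 <->
    augmentation g_neq0 x.1 = augmentation g_neq0 y.1.
  have -> : (x^-1 * y)%g.1 = Qmul g_neq0 (- x.2) (y.1 - x.1).
    by rewrite addrC Qmul_add.
  split=> [/eqP|e]; last first.
    by apply/eqP; rewrite augmentation_Qmul // augmentationB // e subrr.
  by rewrite augmentation_Qmul // augmentationB // subr_eq0 => /eqP.
have modE q r : mod_p (- q + r) = 0 <-> mod_p q = mod_p r.
  rewrite addrC mod_pB; split=> [/eqP|->]; last exact: subrr.
  by rewrite subr_eq0 => /eqP.
split=> [[/augE a /modE b /modE c]|/coset_map1[/augE a /modE b /modE c]].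
  exact/coset_map1.
by rewrite /coset_map a b c.
Qed.

Lemma virtual_endoM (x y : G) :
  coset_map x = coset_map 1%g -> coset_map y = coset_map 1%g ->
  virtual_endo (x * y)%g = (virtual_endo x * virtual_endo y)%g.
Proof.
move=> /coset_map1[_ q0 r0] _.
have cart_lin := cartier_tensor_linear (d := d) p_prime g_neq0.
have xE : x.2 = Qscale p (div_p x.2.1, div_p x.2.2).
  rewrite [LHS]surjective_pairing.
  by congr (_, _); [apply: (mod_p0P _).1 q0 | apply: (mod_p0P _).1 r0].
have -> : virtual_endo (x * y)%g =
    (cartier_tensor g_neq0 (x.1 + Qmul g_neq0 x.2 y.1),
     (div_p (x.2.1 + y.2.1), div_p (x.2.2 + y.2.2))) by [].
rewrite !div_pD // -[x.1]scale1r cart_lin !scale1r {1}xE.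
by rewrite cartier_tensor_Qmul.
Qed.

Lemma pow_dvd_eq0 (z : int) : (forall n, Posz (p ^ n)%N %| z)%Z -> z = 0.
Proof.
move=> zP; apply/eqP; rewrite -absz_eq0.
apply: contraTT (zP `|z|%N) => z_neq0; rewrite dvdzE gtnNdvd ?lt0n //.
exact: ltn_expl (prime_gt1 p_prime).
Qed.

(** The virtual endomorphism divides the Qtilde-component by p, so that this
    component vanishes on the core; the core then lies in Atilde, where it is a
    submodule stable under the Cartier operator. *)
Lemma virtual_endo_core (K : G -> Prop) :
  (forall x y, K x -> K (y * x * y^-1)%g) ->
  (forall x, K x -> coset_map x = coset_map 1%g /\ K (virtual_endo x)) ->
  forall x, K x -> x = 1%g.
Proof.
move=> KJ KH.
have K_dvd n x i : K x ->
    (Posz (p ^ n)%N %| x.2.1 i)%Z /\ (Posz (p ^ n)%N %| x.2.2 i)%Z.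
  elim: n x => [|n IHn] x Kx; first by rewrite !dvd1z.
  have [/coset_map1[_ /mod_p0P q0 /mod_p0P r0] /IHn[/= qn rn]] := KH x Kx.
  rewrite expnS PoszM.
  by split; [rewrite q0 | rewrite r0]; rewrite ffunE dvdz_mul.
have K_Q x : K x -> x.2 = 0.
  move=> Kx; case: x Kx => a [q r] Kx; congr (_, _); apply/ffunP=> i;
    rewrite ffunE; apply: pow_dvd_eq0 => n; by have [] := K_dvd n _ i Kx.
have K_A : forall a, K (a, 0) -> a = 0.
  apply: (invariant_submodule_eq0 p_prime g1_neq0) => [q a Ka|a Ka].
    by have := KJ _ ((0, q) : G) Ka; rewrite (sdprod_conj (Qaction d g_neq0)).
  have [/coset_map1[/= a0 _ _]] := KH _ Ka; split=> //.
  by have := K_Q _ b; move: b; rewrite /virtual_endo /= => Kb e; rewrite -e.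
move=> x Kx; have x2 := K_Q x Kx; case: x Kx x2 => a q Kx /= q0.
by rewrite q0 in Kx *; rewrite (K_A a Kx).
Qed.

Lemma Gtilde_self_similar : transitive_self_similar G.
Proof.
exact: self_similar_of_virtual_endo transversalK coset_mapP virtual_endoM
  virtual_endo_core.
Qed.

End GtildeVirtualEndo.

Theorem theoremD (p d : nat) (g : {poly 'F_p}) (p_prime : prime p)
    (d_gt0 : (0 < d)%N)
    (g_nonmonomial : forall (c : 'F_p) (j : nat), g <> c *: 'X^j)
    (g_nondvd : forall h : {poly 'F_p}, g <> ('X - 1) * h) :
  transitive_self_similar (Gtilde d (nonmonomial_neq0 g_nonmonomial)).
Proof.
apply: Gtilde_self_similar => //; apply/negP=> /factor_theorem[h gE].
by apply: (g_nondvd h); rewrite mulrC -polyC1.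
Qed.
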